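(* Algorithm 1 is a factor-$2$ approximation algorithm for $1|(a,L_j,b,\,b\le a)|\sum C_j$. That is, Algorithm 1 runs in polynomial time, and for every instance with $a_j=a$ and $b_j=b$ for all jobs $j$, where $b\le a$, and arbitrary delays $L_j$, it outputs a feasible schedule whose sum of completion times is at most $2$ times the minimum sum of completion times over all feasible schedules.
   Context: Coupled task scheduling on a single machine: each job $j\in\{1,\dots,n\}$ has a first task of processing time $a_j>0$, a second task of processing time $b_j>0$, and a delay time $L_j\ge 0$. A feasible schedule assigns a starting time $S_j\ge 0$ to each job $j$; the first task occupies $[S_j,S_j+a_j]$, the second task occupies $[S_j+a_j+L_j,\,S_j+a_j+L_j+b_j]$ (the delay is exact, no preemption), and no two of the $2n$ tasks overlap (their intervals have disjoint interiors). Other tasks may be processed during the delay of a job. The completion time of $j$ is $C_j=S_j+a_j+L_j+b_j$, and the objective is to minimize $\sum_{j=1}^n C_j$. Algorithm 1. Input: an instance with $a_j=a$, $b_j=b$ for all $j$. Step 1: sort the jobs in non-decreasing order of $L_j$ and re-index them in this order. Step 2: for $j=1,\dots,n$ in this order, schedule job $j$ as soon as possible with respect to the partial schedule of jobs $1,\dots,j-1$, i.e. set $S_j:=\min\{t\ge 0:\text{ the machine is idle both in }[t,t+a_j]\text{ and in }[t+a_j+L_j,\,t+a_j+L_j+b_j]\}$ (idle meaning that no already scheduled task overlaps the interior of the interval). *)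

(* Defs.v *)
From HB Require Import structures.
From mathcomp Require Import all_boot all_order all_algebra all_fingroup.
Set Implicit Arguments.
Unset Strict Implicit.
Unset Printing Implicit Defensive.
Import Order.TTheory GRing.Theory Num.Theory.
Local Open Scope ring_scope.

Section CoupledTasks.
Variables (R : realFieldType) (n : nat).

(* [a j], [b j] : processing times of the two tasks of job [j]; [L j] : its
   exact delay; [S j] : its starting time. *)
Implicit Types (a L b S : 'I_n -> R).

(* The intervals [s, s + p] and [s', s' + p'] have disjoint interiors. *)
Definition nonoverlapping (s p s' p' : R) : Prop :=
  forall x : R, ~ ((s < x < s + p) /\ (s' < x < s' + p')).

(* The 2n tasks are the pairs [(j, false)] (first task of [j]) and
   [(j, true)] (second task of [j]). *)
Definition task_time a b (u : 'I_n * bool) : R :=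
  if u.2 then b u.1 else a u.1.

Definition task_start a L S (u : 'I_n * bool) : R :=
  if u.2 then S u.1 + a u.1 + L u.1 else S u.1.

Definition feasible a L b S : Prop :=
  (forall j, 0 <= S j) /\
  (forall u v, u != v ->
     nonoverlapping (task_start a L S u) (task_time a b u)
                    (task_start a L S v) (task_time a b v)).

Definition completion a L b S (j : 'I_n) : R := S j + a j + L j + b j.

Definition sum_completion a L b S : R := \sum_j completion a L b S j.

(* The machine is idle in [t, t + d] when only the jobs of [J] are scheduled. *)
Definition idle a L b S (J : {set 'I_n}) (t d : R) : Prop :=
  forall u : 'I_n * bool, u.1 \in J ->
    nonoverlapping t d (task_start a L S u) (task_time a b u).

Definition can_start a L b S (J : {set 'I_n}) (j : 'I_n) (t : R) : Prop :=
  [/\ 0 <= t, idle a L b S J t (a j) & idle a L b S J (t + a j + L j) (b j)].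

(* [S] is an output of the algorithm. The permutation [sigma] is the
   re-indexing: [sigma k] is the job in position [k]. How ties between equal
   delays are broken is left open. *)
Definition algorithm1 a L b S : Prop :=
  exists sigma : {perm 'I_n},
    (forall i j : 'I_n, (i <= j)%N -> L (sigma i) <= L (sigma j)) /\
    (forall k : 'I_n,
       let J := [set sigma i | i : 'I_n & (i < k)%N] in
       can_start a L b S J (sigma k) (S (sigma k)) /\
       (forall t, can_start a L b S J (sigma k) t -> S (sigma k) <= t)).

End CoupledTasks.

(* Machine model for running times: a structured random access machine with
   natural number variables (used as counters and addresses) and arrays of
   rational numbers, under the logarithmic cost criterion: evaluating an
   expression costs the total binary length of the values of all its
   subexpressions. Since the only arithmetic operations are additions,
   subtractions and comparisons, running in polynomial time on this machine is
   the same as running in polynomial time on a Turing machine. *)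

Definition nbits (k : nat) : nat := (trunc_log 2 k).+1.

Definition qbits (q : rat) : nat := (nbits `|numq q|%N + nbits `|denq q|%N)%N.

Inductive iexpr : Type :=
| IVar of nat
| INum of nat
| IAdd of iexpr & iexpr
| ISub of iexpr & iexpr.

(* [QGet A e] is the entry [e] of the array named [A]. *)
Inductive qexpr : Type :=
| QGet of nat & iexpr
| QNum of rat
| QAdd of qexpr & qexpr
| QSub of qexpr & qexpr.

Inductive test : Type :=
| ILt of iexpr & iexpr
| QLt of qexpr & qexpr.

(* [ISet x e] is the assignment x := e, and [QSet A e q] is A[e] := q. *)
Inductive cmd : Type :=
| Skip
| ISet of nat & iexpr
| QSet of nat & iexpr & qexpr
| Seq of cmd & cmd
| If of test & cmd & cmd
| While of test & cmd.

Record state : Type := State {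
  ivar : nat -> nat;
  qarr : nat -> nat -> rat
}.

Fixpoint ieval (s : state) (e : iexpr) : nat :=
  match e with
  | IVar x => ivar s x
  | INum k => k
  | IAdd e1 e2 => (ieval s e1 + ieval s e2)%N
  | ISub e1 e2 => (ieval s e1 - ieval s e2)%N
  end.

Fixpoint qeval (s : state) (q : qexpr) : rat :=
  match q with
  | QGet A e => qarr s A (ieval s e)
  | QNum r => r
  | QAdd q1 q2 => qeval s q1 + qeval s q2
  | QSub q1 q2 => qeval s q1 - qeval s q2
  end.

Definition teval (s : state) (t : test) : bool :=
  match t with
  | ILt e1 e2 => (ieval s e1 < ieval s e2)%N
  | QLt q1 q2 => qeval s q1 < qeval s q2
  end.

Fixpoint icost (s : state) (e : iexpr) : nat :=
  (nbits (ieval s e) +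
   match e with
   | IVar _ | INum _ => 0
   | IAdd e1 e2 | ISub e1 e2 => icost s e1 + icost s e2
   end)%N.

Fixpoint qcost (s : state) (q : qexpr) : nat :=
  (qbits (qeval s q) +
   match q with
   | QGet _ e => icost s e
   | QNum _ => 0
   | QAdd q1 q2 | QSub q1 q2 => qcost s q1 + qcost s q2
   end)%N.

Definition tcost (s : state) (t : test) : nat :=
  match t with
  | ILt e1 e2 => (icost s e1 + icost s e2)%N
  | QLt q1 q2 => (qcost s q1 + qcost s q2)%N
  end.

Definition iset (s : state) (x v : nat) : state :=
  State (fun y => if y == x then v else ivar s y) (qarr s).

Definition qset (s : state) (A i : nat) (r : rat) : state :=
  State (ivar s)
    (fun B k => if (B == A) && (k == i) then r else qarr s B k).

(* [exec c s s' T] : started in [s], the program [c] halts in [s'] at a total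
   cost of [T]. *)
Inductive exec : cmd -> state -> state -> nat -> Prop :=
| exec_Skip s : exec Skip s s 1
| exec_ISet s x e :
    exec (ISet x e) s (iset s x (ieval s e)) (icost s e)
| exec_QSet s A e q :
    exec (QSet A e q) s (qset s A (ieval s e) (qeval s q))
         (icost s e + qcost s q)
| exec_Seq c1 c2 s s1 s2 T1 T2 :
    exec c1 s s1 T1 -> exec c2 s1 s2 T2 -> exec (Seq c1 c2) s s2 (T1 + T2)
| exec_If t c1 c2 s s' T :
    exec (if teval s t then c1 else c2) s s' T ->
    exec (If t c1 c2) s s' (tcost s t + T)
| exec_WhileF t c s :
    ~~ teval s t -> exec (While t c) s s (tcost s t)
| exec_WhileT t c s s1 s2 T1 T2 :
    teval s t -> exec c s s1 T1 -> exec (While t c) s1 s2 T2 ->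
    exec (While t c) s s2 (tcost s t + T1 + T2).

(* Initially variable 0 holds [n], arrays 0, 1 and 2 hold [a], [b] and the
   delays, and everything else is zero. *)
Definition input_state (n : nat) (a b : rat) (L : 'I_n -> rat) : state :=
  State (fun x => if x == 0%N then n else 0%N)
        (fun A k => match A, k with
                    | 0%N, 0%N => a
                    | 1%N, 0%N => b
                    | 2%N, _ => oapp L 0 (insub k)
                    | _, _ => 0
                    end).

(* The starting times are to be found in array 3. *)
Definition output (n : nat) (s : state) (j : 'I_n) : rat := qarr s 3 j.

Definition input_size (n : nat) (a b : rat) (L : 'I_n -> rat) : nat :=
  (qbits a + qbits b + \sum_j qbits (L j))%N.

(* Main.v *)
Require Import Defs.
(* Approximation. Index the jobs from 0 in the order of the algorithm. In any
   schedule the [k+1]-st smallest completion time is at least [(k+1)(a+b)], and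
   the [k+1]-st smallest starting time is at least [k a]; adding the two bounds,
     2 OPT >= \sum_k ((k+1)(a+b) + k a + (a+b+L_k)).
   In the schedule of the algorithm, [[0, S_k)] is covered by the intervals
   [[S_i, S_i+a)] and [[S_i+L_i, S_i+a+L_i+b)] with [i < k], so
   [S_k <= k(2a+b)] and [C_k <= k(2a+b) + (a+b+L_k)].

   Running time. The earliest start of a job is found by jumping from the
   current candidate to the end of a conflict, which never recurs: each pair of
   a scheduled task and a task of the new job causes at most one jump. All
   numbers occurring are multiples of [1/D] bounded by [(n+1) M], where [D] is
   the product of the denominators in the input and [M - 1] the sum of the
   numerators, so they have polynomial length. *)

From mathcomp Require Import all_boot all_order all_algebra all_fingroup.
From mathcomp Require Import zify lra.
Import Order.TTheory GRing.Theory Num.Theory.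
Local Open Scope ring_scope.
Set Implicit Arguments.
Unset Strict Implicit.
Unset Printing Implicit Defensive.

(** * The approximation factor *)

Section Intervals.
Variable R : realFieldType.
Implicit Types (s p t x y : R).

Definition overlap s p s' p' := (s' < s + p) && (s < s' + p').

Lemma nonoverlappingP s p s' p' : 0 < p -> 0 < p' ->
  nonoverlapping s p s' p' <-> ~~ overlap s p s' p'.
Proof.
move=> p0 p0'; split=> [H|/negP H x [/andP[? ?] /andP[? ?]]]; last first.
  by apply: H; apply/andP; split; lra.
apply/negP => /andP[h1 h2].
case: (ltP s s') => h3; case: (ltP (s + p) (s' + p')) => h4.
(* In all four cases the witness is the midpoint of the intersection, which runs from the larger
   start to the smaller end. *)
- by apply: (H ((s' + (s + p)) / 2)); split; apply/andP; split; lra.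
- by apply: (H ((s' + (s' + p')) / 2)); split; apply/andP; split; lra.
- by apply: (H ((s + (s + p)) / 2)); split; apply/andP; split; lra.
- by apply: (H ((s + (s' + p')) / 2)); split; apply/andP; split; lra.
Qed.

(** Induction on the cardinality: the interval [w] with the latest start is removed. All others end
    by [s w], so they fit into [[x, s w]]. *)
Lemma packing (T : finType) (A : {set T}) (s p : T -> R) x y :
  x <= y -> {in A, forall u, x <= s u /\ s u + p u <= y} ->
  {in A &, forall u v, u != v -> ~~ overlap (s u) (p u) (s v) (p v)} ->
  {in A, forall u, 0 < p u} ->
  \sum_(u in A) p u <= y - x.
Proof.
have [m] := ubnP #|A|; elim: m A y => // m IH A y Am xy inA disj p0.
have [->|[w0 w0A]] := set_0Vmem A; first by rewrite big_set0 subr_ge0.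
case: (Order.TotalTheory.arg_maxP s w0A) => w wA wmax.
rewrite (big_setD1 w) //=.
have /inA [xw wy] := wA.
have : \sum_(u in A :\ w) p u <= s w - x; last by lra.
apply: IH => //.
- by move: Am; rewrite (cardsD1 w) (idP wA : w \in A) add1n ltnS.
- move=> u /setD1P[uw uA]; have [xu uy] := inA _ uA; split=> //.
  have /(_ uA) swu : u \in A -> s u <= s w := wmax u.
  have pw := p0 _ wA.
  have := disj _ _ uA wA uw; rewrite /overlap negb_and -!leNgt => /orP[] h; lra.
- by move=> u v /setD1P[_ ?] /setD1P[_ ?]; apply: disj.
- by move=> u /setD1P[_ ?]; apply: p0.
Qed.

(** Induction on the number of intervals: one that contains [x] is removed. Being half-open, it
    misses every point from its right end on, so the others cover what remains. *)
Lemma covering (r : seq (R * R)) x y :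
  {in r, forall I, I.1 <= I.2} ->
  (forall t, x <= t < y -> exists2 I, I \in r & I.1 <= t < I.2) ->
  y - x <= \sum_(I <- r) (I.2 - I.1).
Proof.
have [m] := ubnP (size r); elim: m r x => // m IH r x rm pos cov.
have [yx|xy] := leP y x.
  rewrite (@le_trans _ _ 0) ?subr_le0 // big_seq.
  by apply: sumr_ge0 => I /pos; rewrite subr_ge0.
have [|I Ir /andP[I1 I2]] := cov x; first by rewrite lexx.
rewrite (perm_big _ (perm_to_rem Ir)) big_cons /=.
have : y - I.2 <= \sum_(J <- rem I r) (J.2 - J.1); last by lra.
apply: IH.
- by rewrite size_rem //; case: (r) Ir rm.
- by move=> J /mem_rem/pos.
- move=> t /andP[t1 t2].
  have [|J Jr Jt] := cov t; first by rewrite t2 andbT; lra.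
  exists J => //; move: Jr; rewrite (perm_mem (perm_to_rem Ir)) inE.
  by case/predU1P => // JI; move: Jt; rewrite JI; lra.
Qed.

End Intervals.

(** * Lower bounds on any feasible schedule and the upper bound on greedy ones *)

Section Approximation.
Variables (R : realFieldType) (n : nat) (a b : R) (L : 'I_n -> R).
Hypotheses (a0 : 0 < a) (b0 : 0 < b) (L0 : forall j, 0 <= L j).
Implicit Types (S : 'I_n -> R) (u v : 'I_n * bool).

Local Notation ts := (task_start (fun=> a) L).
Local Notation tt := (task_time (fun=> a) (fun=> b)).
Local Notation feas := (feasible (fun=> a) L (fun=> b)).
Local Notation sumC := (sum_completion (fun=> a) L (fun=> b)).
Local Notation alg := (algorithm1 (fun=> a) L (fun=> b)).

Lemma tt_gt0 u : 0 < tt u.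
Proof. by rewrite /task_time; case: ifP. Qed.

(** After symmetrisation the left side counts each pair of distinct indices exactly once and the
    right side at least once, by totality. This replaces sorting: the number of [e]-predecessors of
    [j] stands for its rank, and ties only increase it. *)
Lemma sum_pair_total (e : rel 'I_n) : total e ->
  (\sum_(j < n) j.+1 <= \sum_(j < n) #|[set i | e i j]|)%N.
Proof.
move=> tot.
have key (f : rel 'I_n) : (\sum_(j < n) #|[set i | f i j]| =
    \sum_(j < n) \sum_(i < n) f i j)%N.
  by apply: eq_bigr => j _; rewrite -sum1dep_card big_mkcond.
have tri : (\sum_(j < n) j.+1 = \sum_(j < n) \sum_(i < n) (i <= j))%N.
  rewrite -key; apply: eq_bigr => j _; rewrite -sum1dep_card.
  have := @big_ord_widen _ 0%N addn j.+1 n (fun=> 1%N) (ltn_ord j).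
  by rewrite big_const_ord iter_addn mul1n addn0 => ->; apply: eq_bigl.
have two (f : rel 'I_n) : (2 * \sum_(j < n) \sum_(i < n) f i j =
    \sum_(j < n) \sum_(i < n) (f i j + f j i))%N.
  rewrite mul2n -addnn {2}exchange_big /= -big_split /=.
  by apply: eq_bigr => j _; rewrite -big_split.
rewrite tri key -(leq_pmul2l (m := 2)) // !two.
apply: leq_sum => j _; apply: leq_sum => i _.
have [->|ij] := eqVneq i j.
  by have := tot j j; rewrite orbb => ->; rewrite leqnn.
have {ij} : i != j :> nat by [].
by have := tot i j; case: (e i j); case: (e j i) => //= _ ij; lia.
Qed.

(** Both tasks of every job completed by time [C j] lie in [[0, C j]], so by packing [C j] is at
    least [a + b] times the number of these jobs. *)
Lemma sumC_ge_work S : feas S -> \sum_(j < n) (j.+1)%:R * (a + b) <= sumC S.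
Proof.
have ha := a0; have hb := b0.
move=> [S0 disj]; pose C := completion (fun=> a) L (fun=> b) S.
rewrite -mulr_suml -natr_sum.
have := @sum_pair_total (fun i j => C i <= C j) (fun i j => le_total _ _).
rewrite -(ler_nat R) => h; have ab : 0 < a + b by lra.
apply: (le_trans (ler_wpM2r (ltW ab) h)); rewrite natr_sum mulr_suml.
apply: ler_sum => j _.
set A := [set i | _].
suff : \sum_(u in setX A [set: bool]) tt u <= C j - 0.
  rewrite subr0; apply: le_trans.
  rewrite (eq_bigl (fun u => (u.1 \in A) && predT u.2)); last first.
    by move=> [i w]; rewrite in_setX in_setT.
  rewrite -(pair_big (mem A) predT (fun i w => tt (i, w))) /=.
  rewrite (eq_bigr (fun=> a + b)); first by rewrite sumr_const -[in leRHS]mulr_natl.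
  by move=> i _; rewrite big_bool /= addrC.
apply: (packing (s := ts S)) => //.
- by have := S0 j; have := L0 j; rewrite /C /completion; lra.
- case=> i w /setXP[]; rewrite inE /task_start /task_time /= => h1 _.
  have := S0 i; have := L0 i; move: h1; rewrite /C /completion.
  by case: w => /=; split; lra.
- move=> u v _ _ uv; apply/nonoverlappingP; rewrite ?tt_gt0 //; exact: disj.
- by move=> u _; exact: tt_gt0.
Qed.

(** The first tasks of all jobs started by [S j] lie in [[0, S j + a]]. The extra [a] on the right
    turns the rank [j + 1] into the factor [j] of the statement. *)
Lemma sumC_ge_start S : feas S ->
  \sum_(j < n) (j%:R * a + (a + L j + b)) <= sumC S.
Proof.
have ha := a0; have hb := b0.
move=> [S0 disj]; rewrite big_split /= /sum_completion.
have -> : \sum_j completion (fun=> a) L (fun=> b) S j =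
    \sum_j S j + \sum_j (a + L j + b).
  rewrite -big_split; apply: eq_bigr => j _; rewrite /completion /=; lra.
rewrite lerD2r -mulr_suml.
have sep i j : i != j -> S i <= S j -> S i + a <= S j.
  move=> ij h.
  have /nonoverlappingP : nonoverlapping (ts S (i, false)) a (ts S (j, false)) a.
    by apply: (disj (i, false) (j, false)); rewrite xpair_eqE (negPf ij).
  rewrite /overlap /task_start /= => /(_ a0 a0).
  by rewrite negb_and -!leNgt => /orP[|]; lra.
have := @sum_pair_total (fun i j => S i <= S j) (fun i j => le_total _ _).
rewrite -(ler_nat R) => h.
have {}h := ler_wpM2r (ltW a0) h.
have : \sum_(j < n) #|[set i | S i <= S j]|%:R * a <= \sum_j (S j + a).
  apply: ler_sum => j _.
  rewrite (_ : _ * a = \sum_(i in [set i | S i <= S j]) a); last first.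
    by rewrite sumr_const mulr_natl.
  rewrite -[S j + a]subr0.
  apply: (packing (s := S)) => //.
  - by have := S0 j; lra.
  - by move=> i; rewrite inE => ij; split=> //; lra.
  - move=> i i' _ _ ii'; rewrite /overlap negb_and -!leNgt.
    by case: (leP (S i) (S i')) => [/(sep _ _ ii') ->|/ltW/sep];
      rewrite ?orbT // eq_sym => ->; rewrite ?orbT.
rewrite natr_sum mulr_suml in h; rewrite natr_sum in h.
rewrite -mulr_suml big_split /= => h2; move: h.
rewrite -mulr_suml (eq_bigr (fun j : 'I_n => j%:R + 1)); last by move=> j _; rewrite -natr1.
rewrite big_split mulrDl /= => h.
have h3 : (\sum_(j < n) 1) * a = \sum_(j < n) a by rewrite !sumr_const card_ord mulr_natl.
by move: h; rewrite h3; lra.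
Qed.

(** Tasks of different jobs are disjoint by the choice of the job scheduled later; the two tasks of
    one job are disjoint because its delay is nonnegative. *)
Lemma algorithm1_feasible S : alg S -> feas S.
Proof.
have ha := a0; have hb := b0.
case=> sigma [_ H].
have S0 j : 0 <= S j.
  by have [[]] := H (sigma^-1%g j); rewrite permKV.
split=> //.
have key (i k : 'I_n) w z : (i < k)%N ->
   nonoverlapping (ts S (sigma k, w)) (tt (sigma k, w)) (ts S (sigma i, z)) (tt (sigma i, z)).
  move=> ik; have [[_ h1 h2] _] := H k.
  by case: w; [apply: h2|apply: h1]; apply/imsetP; exists i; rewrite ?inE.
move=> [i w] [j z]; rewrite -[i](permKV sigma) -[j](permKV sigma).
set i' := (_ i); set j' := (_ j).
case: (ltngtP i' j') => [ij _|ij _|/val_inj -> wz].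
- by move=> x [h1 h2]; apply: (key _ _ z w ij x).
- exact: key.
- have {}wz : w != z by move: wz; rewrite xpair_eqE eqxx.
  move=> x; rewrite /task_start /task_time /=; have := L0 (sigma j').
  by case: w z wz => [] [] //= _ ? [/andP[? ?] /andP[? ?]]; lra.
Qed.

(* A job whose delay is at least that of all jobs started by time [t - a]
   can be blocked at [t] only by a second task meeting [[t, t + a]], because
   [b <= a] makes its own second task end up behind theirs. *)
Lemma algorithm1_start_le S (sigma : {perm 'I_n}) : b <= a ->
  (forall i j : 'I_n, (i <= j)%N -> L (sigma i) <= L (sigma j)) ->
  (forall (k : 'I_n) t,
     can_start (fun=> a) L (fun=> b) S [set sigma i | i : 'I_n & (i < k)%N] (sigma k) t ->
     S (sigma k) <= t) ->
  forall k : 'I_n, S (sigma k) <= k%:R * (2 * a + b).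
Proof.
have ha := a0; have hb := b0.
move=> ba mono opt k.
pose I1 (i : 'I_n) := (S (sigma i), S (sigma i) + a).
(* Up to its left endpoint, [I2 i] is the set of starts whose first task would meet the second task
   of [sigma i]. Hence its length is [a + b] rather than [b]. *)
pose I2 (i : 'I_n) := (S (sigma i) + L (sigma i), S (sigma i) + L (sigma i) + a + b).
pose r : seq 'I_n := [seq i : 'I_n <- enum 'I_n | (i < k)%N].
have := @covering R (map I1 r ++ map I2 r) 0 (S (sigma k)).
rewrite subr0 big_cat !big_map /= !big_filter.
rewrite (eq_bigr (fun=> a)); last by move=> i _; rewrite /I1 /=; lra.
rewrite addrC (eq_bigr (fun=> a + b)); last by move=> i _; rewrite /I2 /=; lra.
have card (c : R) : \sum_(i <- enum 'I_n | (i < k)%N) c = k%:R * c.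
  rewrite big_enum_cond /= (eq_bigl (fun i : 'I_n => (i < k)%N)) //.
  rewrite -(@big_ord_widen _ 0 +%R k n (fun=> c) (ltnW (ltn_ord k))).
  by rewrite sumr_const card_ord mulr_natl.
rewrite !card => H; rewrite (_ : 2 * a + b = a + b + a) ?mulrDr; last by lra.
rewrite mulrDr in H; apply: H.
  move=> I; rewrite mem_cat => /orP[] /mapP[i _ ->] /=; lra.
move=> t /andP[t0 tk].
(* [m] is the first position whose job starts after [t], so all earlier jobs start by [t]. If no
   interval contained [t], then [sigma m] could have started at [t]. *)
case: (@arg_minnP _ k (fun i => t < S (sigma i)) (fun i => nat_of_ord i) tk) => m tm mmin.
have early (i : 'I_n) : (i < m)%N -> S (sigma i) <= t.
  by move=> im; rewrite leNgt; apply/negP => /mmin; rewrite leqNgt im.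
case: (boolP (has (fun I => I.1 <= t < I.2) (map I1 r ++ map I2 r))).
  by move=> /hasP.
move=> /hasPn no; suff : S (sigma m) <= t by rewrite leNgt tm.
have mk : (m <= k)%N by apply: mmin.
have inr (i : 'I_n) : (i < m)%N -> i \in r.
  by move=> im; rewrite mem_filter mem_enum andbT (leq_trans im).
have h1 (i : 'I_n) : (i < m)%N -> S (sigma i) + a <= t.
  move=> im; have /no : I1 i \in map I1 r ++ map I2 r.
    by rewrite mem_cat map_f ?inr.
  by rewrite /= early //= -leNgt.
have h2 (i : 'I_n) : (i < m)%N -> S (sigma i) + L (sigma i) <= t ->
    S (sigma i) + L (sigma i) + a + b <= t.
  move=> im h; have /no : I2 i \in map I1 r ++ map I2 r.
    by rewrite mem_cat orbC map_f ?inr.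
  by rewrite /= h //= -leNgt.
apply: opt; split=> //= -[x w] /= /imsetP[i]; rewrite inE => im -> /=;
  apply/nonoverlappingP; rewrite ?tt_gt0 // /overlap negb_and -!leNgt;
  have := h1 i im; have := L0 (sigma i); have := mono _ _ (ltnW im);
  rewrite /task_start /task_time /=; case: w => /= *.
- case: (leP (S (sigma i) + L (sigma i)) t) => [/(h2 i im)|/ltW] h.
    by apply/orP; right; lra.
  by apply/orP; left; lra.
- by apply/orP; right; lra.
- by apply/orP; right; lra.
- by apply/orP; right; lra.
Qed.

Lemma algorithm1_approx S S' : b <= a -> alg S -> feas S' -> sumC S <= 2 * sumC S'.
Proof.
have ha := a0; have hb := b0.
move=> ba [sigma [mono H]] F.
have hk := algorithm1_start_le ba mono (fun k => (H k).2).
have h1 := sumC_ge_work F; have h2 := sumC_ge_start F.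
suff : sumC S <= \sum_(j < n) (j.+1)%:R * (a + b) +
                 \sum_(j < n) (j%:R * a + (a + L j + b)) by lra.
rewrite [\sum_(j < n) (j%:R * a + _)]big_split /=.
(* Only the delays and the greedy completion times are put into the order of the algorithm; the
   other sums are positional already. *)
rewrite /sum_completion [in X in _ + (_ + X)](reindex_inj (@perm_inj _ sigma)) /=.
rewrite (reindex_inj (@perm_inj _ sigma)) -!big_split /=.
apply: ler_sum => j _; rewrite /completion -natr1; have := hk j; nra.
Qed.

End Approximation.

(** * Existence of greedy schedules *)

Lemma exists_notin (T : finType) (p : seq T) :
  (size p < #|T|)%N -> exists x, x \notin p.
Proof.
move=> h; apply/existsP; rewrite -negb_forall; apply: contraL h => /forallP h.
rewrite -leqNgt (leq_trans _ (card_size p)) //.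
by apply: subset_leq_card; apply/subsetP => x _.
Qed.

Section Greedy.
Variables (R : realFieldType) (n : nat) (a b : R) (L : 'I_n -> R).
Hypotheses (a0 : 0 < a) (b0 : 0 < b).
Implicit Types (S : 'I_n -> R) (J : {set 'I_n}) (i j : 'I_n) (t : R).
Implicit Types (w : ('I_n * bool) * bool) (p : seq 'I_n).

Local Notation ts := (task_start (fun=> a) L).
Local Notation tt := (task_time (fun=> a) (fun=> b)).
Local Notation starts := (can_start (fun=> a) L (fun=> b)).

(* The index [w = (u, v)] stands for a conflict of the scheduled task [u] with
   the task [(j, v)] of the job [j] to be scheduled. *)
Definition blocks S J j t w : bool :=
  (w.1.1 \in J) &&
  overlap (ts (fun=> t) (j, w.2)) (tt (j, w.2)) (ts S w.1) (tt w.1).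

(** The start of [j] for which its task [w.2] begins exactly when the scheduled task [w.1] ends. *)
Definition release S j w : R := ts S w.1 + tt w.1 - ts (fun=> 0) (j, w.2).

(** Potential function of the search. It ranges over all pairs of one of the [2 n] tasks and one of
    the two tasks of [j], so it is at most [4 n]. *)
Definition released S j t : nat := #|[set w | release S j w <= t]|.

Definition earliest S J j t : Prop :=
  starts S J j t /\ forall t', starts S J j t' -> t <= t'.

Lemma task_start_shift j v t : ts (fun=> t) (j, v) = t + ts (fun=> 0) (j, v).
Proof. by rewrite /task_start; case: v => /=; lra. Qed.

Lemma can_startP S J j t :
  starts S J j t <-> 0 <= t /\ forall w, ~~ blocks S J j t w.
Proof.
have tt0 u : 0 < tt u by rewrite /task_time; case: ifP.
split=> [[t0 h1 h2]|[t0 H]]; split=> //.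
- move=> [u []]; rewrite /blocks; apply/negP => /andP[uJ]; apply/negP;
    apply/nonoverlappingP => //; [exact: h2|exact: h1].
- move=> u uJ; have := H (u, false); rewrite /blocks uJ /= => h.
  by apply/nonoverlappingP.
- move=> u uJ; have := H (u, true); rewrite /blocks uJ /= => h.
  by apply/nonoverlappingP.
Qed.

Lemma blocks_lt S J j t w : blocks S J j t w -> t < release S j w.
Proof.
by rewrite /blocks /overlap /release task_start_shift => /and3P[_ _ h]; lra.
Qed.

(** A jump skips no admissible start: at [t'] the task of [j] must lie before or after the scheduled
    task, and it cannot lie before it, since it already overlaps it when started at [t <= t']. *)
Lemma blocks_release S J j t t' w :
  blocks S J j t w -> starts S J j t' -> t <= t' -> release S j w <= t'.
Proof.
move=> /and3P[wJ h1 h2] /can_startP[_ /(_ w)] h tt'.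
move: h h1 h2; rewrite /blocks wJ /overlap /release.
rewrite (task_start_shift _ _ t) (task_start_shift _ _ t').
rewrite andTb negb_and -!leNgt => /orP[] h h1 h2; lra.
Qed.

Lemma ltn_released S J j t t' w : blocks S J j t w -> release S j w <= t' ->
  (released S j t < released S j t')%N.
Proof.
move=> /blocks_lt h1 h2; apply: proper_card; apply/properP; split.
  by apply/subsetP => x; rewrite !inE => h; lra.
by exists w; rewrite inE // -ltNge.
Qed.

Lemma released_le S j t : (released S j t <= 4 * n)%N.
Proof.
apply: (leq_trans (max_card _)); rewrite !card_prod card_ord card_bool; lia.
Qed.

(** From 0, the candidate jumps to the release of some conflict as long as there is one. It stays a
    lower bound on all admissible starts, and [m] bounds the number of conflicts not yet
    released. *)
Lemma earliest_exists S J j : exists t, earliest S J j t.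
Proof.
suff H m t : 0 <= t -> (forall t', starts S J j t' -> t <= t') ->
    (4 * n - released S j t <= m)%N -> exists t', earliest S J j t'.
  by apply: (H (4 * n)%N 0) => //; [move=> t' []|exact: leq_subr].
elim: m t => [|m IH] t t0 low hm.
  case: (pickP (blocks S J j t)) => [w wb|no].
    have := ltn_released wb (lexx _); have := released_le S j (release S j w); lia.
  by exists t; split=> //; apply/can_startP; split=> // w; rewrite no.
case: (pickP (blocks S J j t)) => [w wb|no]; last first.
  by exists t; split=> //; apply/can_startP; split=> // w; rewrite no.
apply: (IH (release S j w)).
- exact: le_trans t0 (ltW (blocks_lt wb)).
- by move=> t' h; apply: blocks_release wb h (low _ h).
- by have := ltn_released wb (lexx _); lia.
Qed.

Lemma eq_earliest S S' J j t : {in J, S =1 S'} ->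
  earliest S J j t -> earliest S' J j t.
Proof.
move=> eS; have e t' w : blocks S J j t' w = blocks S' J j t' w.
  rewrite /blocks; case wJ: (w.1.1 \in J) => //=.
  by rewrite /task_start eS.
have {}e t' : starts S J j t' <-> starts S' J j t'.
  by split=> /can_startP[? H]; apply/can_startP; split=> // w; [rewrite -e|rewrite e].
by move=> [/e ? H]; split=> // t' /e/H.
Qed.

(* Jobs are listed from the most recently scheduled to the first one. *)
Fixpoint greedy_run S p : Prop :=
  if p is j :: p' then
    [/\ j \notin p', forall i, i \notin p' -> L j <= L i,
        earliest S [set i in p'] j (S j) & greedy_run S p']
  else True.

Lemma eq_greedy_run S S' p : {in p, S =1 S'} -> greedy_run S p -> greedy_run S' p.
Proof.
elim: p => //= j p IH eS [jp jL ear run]; split=> //.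
  rewrite -eS ?mem_head //; apply: eq_earliest ear => i.
  by rewrite inE => ip; apply: eS; rewrite inE ip orbT.
by apply: IH => // i ip; apply: eS; rewrite inE ip orbT.
Qed.

Lemma greedy_run_uniq S p : greedy_run S p -> uniq p.
Proof. by elim: p => //= j p IH [-> _ _ /IH]. Qed.

Lemma greedy_run_drop S p j0 m : greedy_run S p -> (m < size p)%N ->
  let j := nth j0 p m in let p' := drop m.+1 p in
  (forall i, i \notin p' -> L j <= L i) /\ earliest S [set i in p'] j (S j).
Proof.
elim: p m => [|j p IH] [|m] //= [jp jL ear run] h; first by rewrite drop0.
exact: IH.
Qed.

Lemma greedy_run_algorithm1 S p : greedy_run S p -> size p = n ->
  algorithm1 (fun=> a) L (fun=> b) S.
Proof.
move=> run sp; have up := greedy_run_uniq run.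
(* [nth] needs a default job; without jobs all conditions are vacuous. *)
case: (posnP n) => [n0|npos].
  by exists 1%g; split=> [i|i]; exfalso; move: (ltn_ord i); rewrite {2}n0.
pose j0 := Ordinal npos.
(* The list is in reverse order of scheduling, so position [k] sits at index [n - (k + 1)], and the
   jobs scheduled before it are those behind it in [p]. *)
pose f (k : 'I_n) := nth j0 p (n - k.+1).
have f_inj : injective f.
  move=> k k' /eqP; rewrite nth_uniq ?sp //; first last.
  - by have := ltn_ord k'; lia.
  - by have := ltn_ord k; lia.
  by move=> /eqP h; apply: val_inj => /=; have := ltn_ord k'; have := ltn_ord k; lia.
have dropE (k : 'I_n) : [set perm f_inj i | i : 'I_n & (i < k)%N] =
    [set i in drop (n - k.+1).+1 p].
  apply/setP => x; rewrite inE; apply/imsetP/idP.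
    move=> [i]; rewrite inE permE => ik ->; rewrite /f.
    have -> : (n - i.+1 = (n - k.+1).+1 + (k - i.+1))%N by have := ltn_ord k; lia.
    rewrite -nth_drop mem_nth // size_drop sp; have := ltn_ord k; lia.
  move=> /(nthP j0)[m]; rewrite size_drop sp nth_drop => hm <-.
  have hi : (k - m.+1 < n)%N by have := ltn_ord k; lia.
  exists (Ordinal hi); rewrite ?inE ?permE /f /=; first lia.
  by congr nth; have := ltn_ord k; lia.
have hs (k : 'I_n) : (n - k.+1 < size p)%N by rewrite sp; have := ltn_ord k; lia.
exists (perm f_inj); split=> [i j ij|k].
  rewrite !permE; have [h _] := greedy_run_drop j0 run (hs i); apply: h.
  apply/negP => /(nthP j0)[m]; rewrite size_drop sp nth_drop => hm /eqP.
  by rewrite /f nth_uniq ?sp //; have := ltn_ord i; have := ltn_ord j; lia.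
rewrite /= dropE permE; exact: (greedy_run_drop j0 run (hs k)).2.
Qed.

(** A run is extended by an unscheduled job of least delay at its earliest start; changing the start
    of a job outside [p] does not affect the run so far. *)
Lemma algorithm1_exists : exists S, algorithm1 (fun=> a) L (fun=> b) S.
Proof.
suff H m : (m <= n)%N -> exists S p, size p = m /\ greedy_run S p.
  by have [S [p [sp run]]] := H n (leqnn n); exists S; apply: greedy_run_algorithm1 run sp.
elim: m => [|m IH] mn; first by exists (fun=> 0), [::].
have [S [p [sp run]]] := IH (ltnW mn).
have [j0 j0p] : exists i, i \notin p by apply: exists_notin; rewrite sp card_ord.
case: (@Order.TotalTheory.arg_minP _ _ _ j0 (fun j => j \notin p) L j0p) => j jp jmin.
have [t ht] := earliest_exists S [set i in p] j.
pose S' i := if i == j then t else S i.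
have eS : {in p, S =1 S'}.
  by move=> i ip; rewrite /S' ifN //; apply: contraNneq jp => <-.
exists S', (j :: p); rewrite /= sp; split=> //; split=> //.
  by rewrite {2}/S' eqxx; apply: eq_earliest ht => i; rewrite inE; apply: eS.
exact: eq_greedy_run run.
Qed.

End Greedy.

(** * Lengths of numbers *)

Section BinaryLength.
Local Open Scope nat_scope.

Lemma nbits_ltn x : x < 2 ^ nbits x.
Proof. exact: trunc_log_ltn. Qed.

Lemma nbits_min x m : 0 < m -> x < 2 ^ m -> nbits x <= m.
Proof.
case: x => [|x] m0 h; first by rewrite /nbits trunc_log0.
have /andP[h1 _] := trunc_log_bounds (isT : 1 < 2) (isT : 0 < x.+1).
by rewrite /nbits -(ltn_exp2l _ _ (isT : 1 < 2)) (leq_ltn_trans h1).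
Qed.

Lemma leq_nbits x y : x <= y -> nbits x <= nbits y.
Proof. by move=> xy; apply: nbits_min => //; apply: leq_ltn_trans xy (nbits_ltn y). Qed.

Lemma nbits_mul x y : nbits (x * y) <= nbits x + nbits y.
Proof. by apply: nbits_min => //; rewrite expnD ltn_mul ?nbits_ltn. Qed.

Lemma nbits_add x y : nbits (x + y) <= nbits x + nbits y.
Proof.
apply: nbits_min => //; rewrite expnD.
have := nbits_ltn x; have := nbits_ltn y.
(* A sum of two numbers that are at least 2 is at most their product; this is applied to the two
   powers. *)
have h z : 2 <= 2 ^ nbits z by rewrite -{1}(expn1 2) leq_exp2l.
by have := h x; have := h y; nia.
Qed.

Lemma nbits_mull m x : 0 < m -> nbits (m * x) <= m * nbits x.
Proof.
elim: m => // -[|m] IH _; first by rewrite !mul1n.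
by rewrite mulSn [X in _ <= X]mulSn (leq_trans (nbits_add _ _)) // leq_add2l IH.
Qed.

Lemma nbits_leqS x : nbits x <= x.+1.
Proof. by apply: nbits_min => //; rewrite (ltn_trans (ltnSn x)) // ltn_expl. Qed.

Lemma nbits_prod (I : Type) (r : seq I) (f : I -> nat) :
  nbits (\prod_(i <- r) f i) <= 1 + \sum_(i <- r) nbits (f i).
Proof.
elim: r => [|i r IH]; first by rewrite !big_nil.
by rewrite !big_cons; have := nbits_mul (f i) (\prod_(j <- r) f j); lia.
Qed.

Lemma nbits_sum (I : Type) (r : seq I) (f : I -> nat) :
  nbits (\sum_(i <- r) f i) <= 1 + \sum_(i <- r) nbits (f i).
Proof.
elim: r => [|i r IH]; first by rewrite !big_nil.
by rewrite !big_cons; have := nbits_add (f i) (\sum_(j <- r) f j); lia.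
Qed.

End BinaryLength.

(** * Rationals with a common denominator and bounded absolute value *)

Section Grid.
Variable D : nat.
Hypothesis D0 : (0 < D)%N.

(** Additions and subtractions keep the denominator [D] and only add the bounds [K], so lengths do
    not blow up along the computation. *)
Definition grid (K : nat) (q : rat) : bool :=
  (q * D%:R \is a Num.int) && (`|q| <= K%:R).

Lemma gridD K K' q q' : grid K q -> grid K' q' -> grid (K + K') (q + q').
Proof.
move=> /andP[i h] /andP[i' h']; rewrite /grid mulrDl rpredD //=.
by rewrite natrD (le_trans (ler_normD _ _)) // lerD.
Qed.

Lemma gridB K K' q q' : grid K q -> grid K' q' -> grid (K + K') (q - q').
Proof.
move=> g /andP[i' h']; apply: gridD => //.
by rewrite /grid mulNr rpredN i' normrN.
Qed.

Lemma gridW K K' q : (K <= K')%N -> grid K q -> grid K' q.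
Proof. by move=> KK /andP[i h]; rewrite /grid i (le_trans h) // ler_nat. Qed.

Lemma grid_nat K x : (x <= K)%N -> grid K x%:R.
Proof. by move=> h; rewrite /grid rpredM ?natr_int //= normr_nat ler_nat. Qed.

(** The reduced denominator is coprime to the numerator and hence divides [D]; the numerator is then
    at most [K * D] in absolute value. *)
Lemma grid_qbits K q : grid K q -> (qbits q <= nbits (K * D) + nbits D)%N.
Proof.
move=> /andP[/intrP[z hz] hK].
have dq : (denq q)%:~R != 0 :> rat by rewrite intr_eq0 denq_neq0.
have eqz : (numq q * D%:Z = z * denq q)%R.
  apply: (@intr_inj rat); rewrite !intrM -hz -{2}(divq_num_den q) -pmulrn.
  by rewrite mulrAC divfK.
have dvd : (`|denq q| %| D)%N.
  have : (`|denq q| %| `|numq q| * D)%N.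
    by rewrite -[D in (_ * D)%N]absz_nat -abszM eqz abszM dvdn_mull.
  by rewrite Gauss_dvdr // coprime_sym coprime_num_den.
have dD := dvdn_leq D0 dvd.
have num : (`|numq q| <= K * D)%N.
  rewrite -(ler_nat rat) natrM.
  have -> : `|numq q|%:R = `|q| * `|denq q|%:R :> rat.
    rewrite -{2}(divq_num_den q) normf_div mulrC.
    rewrite -!intr_norm !natr_absz.
    by rewrite mulrC divfK // intr_norm normr_eq0.
  by apply: ler_pM => //; rewrite ler_nat.
by rewrite /qbits leq_add ?leq_nbits.
Qed.

End Grid.

(** * A cost logic for the machine *)

(** A constant [k] weighs [k + 1], so that values are at most [isize e * N] when all variables are
    at most [N > 0]. *)
Fixpoint isize (e : iexpr) : nat :=
  match e with
  | IVar _ => 1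
  | INum k => k.+1
  | IAdd e1 e2 | ISub e1 e2 => (isize e1 + isize e2).+1
  end.

Fixpoint qsize (q : qexpr) : nat :=
  match q with
  | QGet _ e => (isize e).+1
  | QNum _ => 1
  | QAdd q1 q2 | QSub q1 q2 => (qsize q1 + qsize q2).+1
  end.

(** The constants 0 and 1 lie in every grid with [K > 0], which justifies their weight 1 in
    [qsize]. *)
Fixpoint binary_consts (q : qexpr) : bool :=
  match q with
  | QGet _ _ => true
  | QNum r => (r == 0) || (r == 1)
  | QAdd q1 q2 | QSub q1 q2 => binary_consts q1 && binary_consts q2
  end.

Definition tsize (t : test) : nat :=
  match t with
  | ILt e1 e2 => (isize e1 + isize e2)%N
  | QLt q1 q2 => (qsize q1 + qsize q2)%N
  end.

Definition test_consts (t : test) : bool :=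
  if t is QLt q1 q2 then binary_consts q1 && binary_consts q2 else true.

Fixpoint assigns (c : cmd) (x : nat) : bool :=
  match c with
  | Skip | QSet _ _ _ => false
  | ISet y _ => y == x
  | Seq c1 c2 | If _ c1 c2 => assigns c1 x || assigns c2 x
  | While _ c => assigns c x
  end.

Lemma exec_frame c s s' T x :
  exec c s s' T -> ~~ assigns c x -> ivar s' x = ivar s x.
Proof.
elim=> //=.
- by move=> {}s y e; rewrite eq_sym => /negPf ->.
- by move=> c1 c2 ? ? ? ? ? _ IH1 _ IH2 /norP[? ?]; rewrite IH2 ?IH1.
- by move=> {}s t c1 c2 ? ? _ IH /norP[? ?]; rewrite IH //; case: ifP.
- by move=> t {}c ? ? ? ? ? _ _ IH1 _ IH2 nx; rewrite IH2 ?IH1.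
Qed.

Section CostLogic.
Variables (D K N U : nat).
Hypotheses (D0 : (0 < D)%N) (K0 : (0 < K)%N) (N0 : (0 < N)%N).

Definition wordsize : nat := (nbits (K * D) + nbits D + nbits N)%N.

(** [U] is the unit of cost. Costs are quadratic in the size of an expression, and [31 ^ 2 <= 1000],
    so everything of total size at most 31 costs at most one unit. *)
Hypothesis U_large : (1000 * wordsize <= U)%N.

Definition bounded (s : state) : Prop :=
  (forall x, (ivar s x <= N)%N) /\ (forall A i, grid D K (qarr s A i)).

Lemma ieval_le s e : bounded s -> (ieval s e <= isize e * N)%N.
Proof.
have n0 := N0.
case=> bi _; elim: e => [x|k|e1 IH1 e2 IH2|e1 IH1 e2 IH2] /=.
- by rewrite mul1n.
- by nia.
- by nia.
- by nia.
Qed.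

Lemma isize_gt0 e : (0 < isize e)%N.
Proof. by case: e. Qed.

Lemma qsize_gt0 q : (0 < qsize q)%N.
Proof. by case: q. Qed.

(** Each subexpression has a value of at most [isize e * nbits N] bits, and there are at most
    [isize e] of them. *)
Lemma icost_le s e : bounded s -> (icost s e <= isize e ^ 2 * nbits N)%N.
Proof.
move=> bs.
have h e' : (nbits (ieval s e') <= isize e' * nbits N)%N.
  apply: leq_trans (nbits_mull _ (isize_gt0 e')).
  exact: leq_nbits (ieval_le _ bs).
elim: e => [x|k|e1 IH1 e2 IH2|e1 IH1 e2 IH2].
- by have := h (IVar x); rewrite /= addn0.
- by have := h (INum k); rewrite /= addn0; nia.
- have := h (IAdd e1 e2); rewrite /=; nia.
- have := h (ISub e1 e2); rewrite /=; nia.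
Qed.

Lemma qeval_grid s q : bounded s -> binary_consts q ->
  grid D (qsize q * K) (qeval s q).
Proof.
have k0 := K0.
case=> _ bq; elim: q => [A e|r|q1 IH1 q2 IH2|q1 IH1 q2 IH2] /=.
- by move=> _; apply: gridW (bq _ _); nia.
- by case/orP=> /eqP ->; [apply: (grid_nat _ (x := 0))|apply: (grid_nat _ (x := 1))]; lia.
- move=> /andP[/IH1 g1 /IH2 g2]; apply: gridW (gridD g1 g2); nia.
- move=> /andP[/IH1 g1 /IH2 g2]; apply: gridW (gridB g1 g2); nia.
Qed.

Lemma qcost_le s q : bounded s -> binary_consts q ->
  (qcost s q <= qsize q ^ 2 * wordsize)%N.
Proof.
move=> bs.
have h q' : binary_consts q' -> (qbits (qeval s q') <= qsize q' * wordsize)%N.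
  move=> c; apply: (leq_trans (grid_qbits D0 (qeval_grid bs c))).
  have q0 := qsize_gt0 q'.
  have := nbits_mull (K * D) q0; rewrite mulnA /wordsize; nia.
elim: q => [A e|r|q1 IH1 q2 IH2|q1 IH1 q2 IH2] c; have {}h := h _ c.
- have := icost_le e bs; move: h; rewrite /= /wordsize; nia.
- by move: h; rewrite /= addn0; nia.
- move: c h => /= /andP[/IH1 h1 /IH2 h2]; nia.
- move: c h => /= /andP[/IH1 h1 /IH2 h2]; nia.
Qed.

Lemma tcost_le s t : bounded s -> test_consts t -> (tsize t <= 31)%N ->
  (tcost s t <= U)%N.
Proof.
have UW := U_large; move=> bs; case: t => [e1 e2 _|q1 q2 /= /andP[c1 c2]] /= h.
  have := icost_le e1 bs; have := icost_le e2 bs; move: UW; rewrite /wordsize.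
  move: (isize e1) (isize e2) h => x y h; have : (x ^ 2 + y ^ 2 <= 1000)%N by nia.
  nia.
have := qcost_le bs c1; have := qcost_le bs c2.
move: (qsize q1) (qsize q2) h => x y h; have : (x ^ 2 + y ^ 2 <= 1000)%N by nia.
nia.
Qed.

Lemma U_gt0 : (0 < U)%N.
Proof. by apply: leq_trans U_large; rewrite muln_gt0 /wordsize /nbits. Qed.

Lemma icost_leU s e : bounded s -> (isize e <= 31)%N -> (icost s e <= U)%N.
Proof.
move=> /(icost_le e) h he; apply: leq_trans h (leq_trans _ U_large).
by apply: leq_mul; [nia|exact: leq_addl].
Qed.

(** Hoare triple for total correctness, with the running time counted in units of [U]. *)
Definition triple (P : state -> Prop) (c : cmd) (Q : state -> Prop) (tau : nat) :=
  forall s, P s -> exists s' T, [/\ exec c s s' T, (T <= tau * U)%N & Q s'].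

Lemma triple_weaken (P P' Q Q' : state -> Prop) c tau tau' :
  (forall s, P' s -> P s) -> (forall s, Q s -> Q' s) -> (tau <= tau')%N ->
  triple P c Q tau -> triple P' c Q' tau'.
Proof.
move=> hP hQ ht H s /hP/H[s' [T [e hT q]]]; exists s', T; split=> //; last exact: hQ.
by rewrite (leq_trans hT) // leq_mul2r ht orbT.
Qed.

Lemma triple_skip (P Q : state -> Prop) tau : (0 < tau)%N ->
  (forall s, P s -> Q s) -> triple P Skip Q tau.
Proof.
move=> t0 H s p; exists s, 1%N; split; [constructor|by rewrite muln_gt0 t0 U_gt0|exact: H].
Qed.

Lemma triple_iset (P Q : state -> Prop) x e tau : (isize e <= 31)%N -> (0 < tau)%N ->
  (forall s, P s -> bounded s /\ Q (iset s x (ieval s e))) ->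
  triple P (ISet x e) Q tau.
Proof.
move=> he t0 H s /H[b q]; exists (iset s x (ieval s e)), (icost s e).
split=> //; first by constructor.
by rewrite (leq_trans (icost_leU b he)) // leq_pmull.
Qed.

Lemma triple_qset (P Q : state -> Prop) A e q :
  (isize e + qsize q <= 31)%N -> binary_consts q ->
  (forall s, P s -> bounded s /\ Q (qset s A (ieval s e) (qeval s q))) ->
  triple P (QSet A e q) Q 1.
Proof.
move=> he hc H s /H[b hq].
exists (qset s A (ieval s e) (qeval s q)), (icost s e + qcost s q)%N.
split=> //; first by constructor.
rewrite mul1n; apply: leq_trans (leq_add (icost_le e b) (qcost_le b hc)) _.
apply: leq_trans _ U_large.
apply: (@leq_trans ((isize e ^ 2 + qsize q ^ 2) * wordsize)).
  by rewrite mulnDl leq_add2r leq_mul2l leq_addl orbT.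
by rewrite leq_mul2r; apply/orP; right; nia.
Qed.

Lemma triple_seq (P Q R : state -> Prop) c1 c2 tau1 tau2 :
  triple P c1 Q tau1 -> triple Q c2 R tau2 -> triple P (Seq c1 c2) R (tau1 + tau2).
Proof.
move=> H1 H2 s /H1[s1 [T1 [e1 t1 /H2[s2 [T2 [e2 t2 r]]]]]].
exists s2, (T1 + T2)%N; split=> //; first exact: exec_Seq e1 e2.
by rewrite mulnDl leq_add.
Qed.

Lemma triple_if (P Q : state -> Prop) t c1 c2 tau :
  test_consts t -> (tsize t <= 31)%N -> (forall s, P s -> bounded s) ->
  triple (fun s => P s /\ teval s t) c1 Q tau ->
  triple (fun s => P s /\ ~~ teval s t) c2 Q tau ->
  triple P (If t c1 c2) Q tau.+1.
Proof.
move=> hc ht hb H1 H2 s p.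
have [s' [T [e hT q]]] : exists s' T,
    [/\ exec (if teval s t then c1 else c2) s s' T, (T <= tau * U)%N & Q s'].
  by case: ifP => h; [apply: H1|apply: H2; rewrite h].
exists s', (tcost s t + T)%N; split=> //; first exact: exec_If.
by rewrite mulSn leq_add // tcost_le //; apply: hb.
Qed.

Definition For x e c :=
  Seq (ISet x (INum 0)) (While (ILt (IVar x) e) (Seq c (ISet x (IAdd (IVar x) (INum 1))))).

(** The initial assignment and the last, failing test cost 2; each round adds a test and an
    increment to its body. *)
Definition for_cost (m tau : nat) : nat := (2 + m * (tau + 2))%N.

Lemma triple_for (I : nat -> state -> Prop) x e c m tau :
  (isize e <= 30)%N -> ~~ assigns c x ->
  (forall i s, I i s -> bounded s /\ ieval s e = m) ->
  (forall i v s, I i s -> (v <= m)%N -> I i (iset s x v)) ->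
  (forall i, (i < m)%N ->
     triple (fun s => ivar s x = i /\ I i s) c (I i.+1) tau) ->
  triple (I 0%N) (For x e c) (I m) (for_cost m tau).
Proof.
move=> he hx hI hset H.
(* Induction on the number [k] of rounds still to come; [exec_frame] shows that the body leaves the
   counter alone. *)
have loop k i s : (i + k = m)%N -> ivar s x = i -> I i s ->
    exists s' T, [/\ exec (While (ILt (IVar x) e) (Seq c (ISet x (IAdd (IVar x) (INum 1))))) s s' T,
                  (T <= (1 + k * (tau + 2)) * U)%N & I m s'].
  elim: k i s => [|k IH] i s ik xi Ii; have [bs es] := hI _ _ Ii.
    exists s, (tcost s (ILt (IVar x) e)); split.
    - by apply: exec_WhileF; rewrite /= es xi; lia.
    - by rewrite mul0n addn0 mul1n tcost_le //=; lia.
    - by rewrite -ik addn0.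
  have im : (i < m)%N by lia.
  have [s1 [T1 [e1 t1 I1]]] := H i im s (conj xi Ii).
  have x1 : ivar s1 x = i by rewrite (exec_frame e1 hx).
  have [b1 _] := hI _ _ I1.
  have [||| s2 [T2 [e2 t2 I2]]] := IH i.+1 (iset s1 x i.+1).
  - by lia.
  - by rewrite /= eqxx.
  - exact: hset.
  have c1 : (icost s1 (IAdd (IVar x) (INum 1)) <= U)%N. by apply: icost_leU.
  have ct : (tcost s (ILt (IVar x) e) <= U)%N by rewrite tcost_le //=; lia.
  exists s2, (tcost s (ILt (IVar x) e) + (T1 + icost s1 (IAdd (IVar x) (INum 1))) + T2)%N.
  split=> //.
    apply: (exec_WhileT _ _ e2); first by rewrite /= es xi; lia.
    apply: exec_Seq e1 _.
    rewrite (_ : i.+1 = ieval s1 (IAdd (IVar x) (INum 1))); last by rewrite /= x1 addn1.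
    exact: exec_ISet.
  rewrite mulSn; move: c1 ct t1 t2; nia.
rewrite /for_cost -[2%N]/(1 + 1)%N -addnA; apply: triple_seq.
  apply: (@triple_iset _ (fun s => ivar s x = 0%N /\ I 0%N s)) => //.
  move=> s Is; have [bs _] := hI _ _ Is; split=> //; split; first by rewrite /= eqxx.
  exact: hset.
by move=> s [x0 Is]; apply: (loop m 0%N).
Qed.

End CostLogic.

(** * The program *)

(* Variables: 0 holds [n], 1 counts the scheduled jobs, 2 scans the jobs, 3 is
   the job being scheduled, 4 counts the passes. Array 4 marks the scheduled
   jobs by 1; the tentative start of the current job is kept in its entry of
   array 3. *)
Definition start_expr (x : nat) (z : bool) : qexpr :=
  if z then QAdd (QAdd (QGet 3 (IVar x)) (QGet 0 (INum 0))) (QGet 2 (IVar x))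
  else QGet 3 (IVar x).

Definition time_expr (z : bool) : qexpr := QGet (if z then 1 else 0)%N (INum 0).

(** The nested tests are the two halves of [overlap]; the assignment moves the tentative start to
    the [release] of the conflict found. *)
Definition resolve (z v : bool) : cmd :=
  If (QLt (start_expr 2 z) (QAdd (start_expr 3 v) (time_expr v)))
    (If (QLt (start_expr 3 v) (QAdd (start_expr 2 z) (time_expr z)))
       (QSet 3 (IVar 3)
          (QAdd (QGet 3 (IVar 3))
             (QSub (QAdd (start_expr 2 z) (time_expr z)) (start_expr 3 v))))
       Skip)
    Skip.

Definition resolve_job : cmd :=
  If (QLt (QGet 4 (IVar 2)) (QNum 1)) Skip
    (Seq (resolve false false) (Seq (resolve false true)
       (Seq (resolve true false) (resolve true true)))).

Definition pass : cmd := For 2 (IVar 0) resolve_job.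

(* Each pass that moves the tentative start releases one of the [4 n]
   conflicts for good, so [4 n + 1] passes are enough. *)
Definition pass_count : iexpr :=
  IAdd (IAdd (IAdd (IVar 0) (IVar 0)) (IAdd (IVar 0) (IVar 0))) (INum 1).

Definition place : cmd := For 4 pass_count pass.

(** The initial candidate, job 0, may be scheduled already. The test of the candidate's own mark
    lets any unscheduled job replace it. *)
Definition select : cmd :=
  Seq (ISet 3 (INum 0))
    (For 2 (IVar 0)
       (If (QLt (QGet 4 (IVar 2)) (QNum 1))
          (If (QLt (QGet 4 (IVar 3)) (QNum 1))
             (If (QLt (QGet 2 (IVar 2)) (QGet 2 (IVar 3))) (ISet 3 (IVar 2)) Skip)
             (ISet 3 (IVar 2)))
          Skip)).

Definition schedule_next : cmd :=
  Seq select (Seq (QSet 3 (IVar 3) (QNum 0)) (Seq place (QSet 4 (IVar 3) (QNum 1)))).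

Definition schedule_all : cmd := For 1 (IVar 0) schedule_next.

Section Program.
Variables (n : nat) (a b : rat) (L : 'I_n -> rat).
Variables (D M U : nat).
(** Each scheduled job raises the bound on the starting times by [M]; the successor keeps [K] at
    least [M] even for [n = 0]. The largest counter value is the number [N] of passes. *)
Let K := (n.+1 * M)%N.
Let N := (4 * n + 1)%N.
Hypotheses (a0 : 0 < a) (b0 : 0 < b) (L0 : forall j, 0 <= L j).
Hypotheses (D0 : (0 < D)%N) (M0 : (0 < M)%N).
Hypothesis abL_le : forall j, a + b + L j <= M%:R.
Hypothesis U_large : (1000 * wordsize D K N <= U)%N.

Local Notation ts := (task_start (fun=> a) L).
Local Notation tt := (task_time (fun=> a) (fun=> b)).
Local Notation starts := (can_start (fun=> a) L (fun=> b)).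
Local Notation triple := (triple U).
Local Notation bounded := (bounded D K N).

Let K0 : (0 < K)%N. Proof. by rewrite muln_gt0 M0. Qed.
Let N0 : (0 < N)%N. Proof. by rewrite /N addn1. Qed.

Definition sol (s : state) (j : 'I_n) : rat := qarr s 3 j.

Definition wf (s : state) : Prop :=
  [/\ bounded s, ivar s 0 = n, qarr s 0 0 = a, qarr s 1 0 = b
    & forall j : 'I_n, qarr s 2 j = L j].

Definition marks (p : seq 'I_n) (s : state) : Prop :=
  forall j : 'I_n, qarr s 4 j = (j \in p)%:R.

Lemma wf_bounded s : wf s -> bounded s.
Proof. by case. Qed.

Lemma wf_iset s x v : wf s -> x != 0%N -> (v <= N)%N -> wf (iset s x v).
Proof.
move=> [[bi bq] h0 ha hb hL] x0 vN; split=> //=; last by rewrite eq_sym (negPf x0).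
by split=> // y /=; case: ifP.
Qed.

Lemma wf_qset s A i r : wf s -> (2 < A)%N -> grid D K r -> wf (qset s A i r).
Proof.
move=> [[bi bq] h0 ha hb hL] A2 gr; split=> //=.
- by split=> // B k /=; case: ifP.
- by rewrite ifN //; case: A A2.
- by rewrite ifN //; case: A A2 => [|[]].
- by move=> j; rewrite ifN //; case: A A2 => [|[|[]]].
Qed.

(** * Search for the earliest start of one job *)

Section Search.
Variables (p : seq 'I_n) (j : 'I_n) (S0 : 'I_n -> rat) (k : nat).
Hypotheses (jp : j \notin p) (kn : (k < n)%N).
Hypothesis S0_le : forall i, i \in p -> 0 <= S0 i <= (k * M)%:R.
Local Notation J := [set i in p].

(** The last clause is the core of the invariant: the tentative start never exceeds an admissible
    one, so it is earliest as soon as it is admissible. *)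
Definition searching (s : state) : Prop :=
  [/\ wf s, ivar s 3 = j, marks p s, {in p, sol s =1 S0}
    & [/\ 0 <= sol s j, sol s j <= (k.+1 * M)%:R
        & forall t, starts S0 J j t -> sol s j <= t]].

(** Progress of a pass begun at the tentative start [t0]: either it has not moved and no conflict in
    [C] blocks it, or it has moved and the potential has grown. *)
Definition checked (C : pred (('I_n * bool) * bool)) (t0 : rat) (s : state) : Prop :=
  [/\ searching s, t0 <= sol s j
    & (sol s j = t0 /\ forall w, C w -> ~~ blocks a b L S0 J j t0 w) \/
      (released a b L S0 j t0 < released a b L S0 j (sol s j))%N].

Lemma searching_iset s x v : searching s -> x != 0%N -> x != 3%N -> (v <= N)%N ->
  searching (iset s x v).
Proof.
move=> [h1 h2 h3 h4 h5] x0 x3 vN; split=> //; first exact: wf_iset.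
by rewrite /= eq_sym (negPf x3).
Qed.

Lemma release_le (i : 'I_n) z v : i \in p ->
  release a b L S0 j ((i, z), v) <= (k.+1 * M)%:R.
Proof.
move=> /S0_le; have := L0 i; have := L0 j; have := abL_le i; have := a0; have := b0.
rewrite mulSnr natrD /release /task_start /task_time /=.
by case: z; case: v => /=; lra.
Qed.

Lemma resolve_triple (C : pred (('I_n * bool) * bool)) t0 (i : 'I_n) z v : i \in p ->
  triple (fun s => ivar s 2 = i /\ checked C t0 s) (resolve z v)
         (fun s => ivar s 2 = i /\ checked (predU1 ((i, z), v) C) t0 s) 3.
Proof.
move=> ip; pose w := ((i, z), v).
have evt s (x : 'I_n) y : wf s -> qarr s (if y then 1 else 0)%N 0 = tt (x, y).
  by move=> [_ _ ha hb _]; case: y.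
have evi s : ivar s 2 = i -> checked C t0 s -> qeval s (start_expr 2 z) = ts S0 (i, z).
  move=> i2 [[[_ _ ha _ hL] _ _ hS _] _ _]; rewrite /task_start -(hS i ip).
  by case: (z); rewrite /= i2 ?ha ?hL.
have evj s : checked C t0 s ->
    qeval s (start_expr 3 v) = sol s j + ts (fun=> 0) (j, v).
  move=> [[[_ _ ha _ hL] j3 _ _ _] _ _]; rewrite -task_start_shift /task_start.
  by case: (v); rewrite /= j3 ?ha ?hL.
have wJ : w.1.1 \in J by rewrite inE.
have keep s : ivar s 2 = i -> checked C t0 s -> ~~ blocks a b L S0 J j (sol s j) w ->
    checked (predU1 w C) t0 s.
  move=> i2 [h1 h2 [[h3 h4]|h3]] nb; split=> //; [left|by right].
  by split=> // w' /predU1P[->|/h4 //]; rewrite -h3.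
have bl s : ivar s 2 = i -> checked C t0 s -> blocks a b L S0 J j (sol s j) w =
    (ts S0 (i, z) < sol s j + ts (fun=> 0) (j, v) + tt (j, v)) &&
    (sol s j + ts (fun=> 0) (j, v) < ts S0 (i, z) + tt (i, z)).
  by move=> i2 h; rewrite /blocks wJ /overlap task_start_shift.
have cwf s : checked C t0 s -> wf s by case=> [[]].
apply: (triple_if D0 K0 N0 U_large) => //; first by case: (z); case: (v).
- by case: (z); case: (v).
- by move=> s [_ /cwf/wf_bounded].
- apply: (triple_if D0 K0 N0 U_large) => //; first by case: (z); case: (v).
  + by case: (z); case: (v).
  + by move=> s [[_ /cwf/wf_bounded]].
  + apply: (triple_qset D0 K0 N0 U_large) => //; [by case: (z); case: (v)..|].
    move=> s [[[i2 cs] lt1] lt2]; have ws := cwf _ cs; split; first exact: wf_bounded.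
    have wb : blocks a b L S0 J j (sol s j) w.
      rewrite bl //; apply/andP; move: lt1 lt2.
      by rewrite /= evi // evj // !(evt s j _ ws).
    set q := QAdd _ _.
    have [[_ j3 mk hS [t_ge t_le low]] t0s disj] := cs.
    have qE : qeval s q = release a b L S0 j w.
      by rewrite /q /= evi // evj // (evt s i _ ws) j3 -/(sol s j) /release /=; lra.
    have rt := blocks_lt wb.
    (* [qeval_grid] supplies only integrality here, since its bound grows with the expression; the
       size comes from [release_le]. *)
    have gr : grid D K (qeval s q).
      have cq : binary_consts q by rewrite /q; case: (z); case: (v).
      have /andP[hi _] := qeval_grid D0 K0 N0 U_large (wf_bounded ws) cq.
      rewrite /grid hi qE ger0_norm ?(le_trans t_ge (ltW rt)) //=.
      by apply: le_trans (release_le _ _ ip) _; rewrite ler_nat leq_mul2r ltnS ltnW ?orbT.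
    have solE r x : sol (qset s 3 (ieval s (IVar 3)) r) x =
        if x == j then r else sol s x.
      by rewrite /sol /= j3 val_eqE.
    have solj := solE (qeval s q) j; rewrite eqxx qE in solj; rewrite qE in gr *.
    split=> //; split; last 1 first.
    * by right; rewrite solj; case: disj => [[<- _]|h];
        [exact: ltn_released wb _|apply: (ltn_trans h); exact: ltn_released wb _].
    * split=> //; first exact: wf_qset.
        move=> x xp; rewrite solE ifN ?hS //; by apply: contraNneq jp => <-.
      rewrite solj; split; first exact: le_trans t_ge (ltW rt).
        exact: release_le.
      by move=> t st; apply: (blocks_release a0 b0 wb st); exact: low.
    * by rewrite solj (le_trans t0s) // ltW.
  + apply: (triple_skip U_large) => // s [[[i2 cs] lt1] lt2]; split=> //; apply: keep => //.
    rewrite bl // negb_and; apply/orP; right; move: lt2.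
    by rewrite /= evi // evj // !(evt s j _ (cwf _ cs)).
- apply: (triple_skip U_large) => // s [[i2 cs] lt1].
  split=> //; apply: keep => //.
  rewrite bl // negb_and; apply/orP; left; move: lt1.
  by rewrite /= evi // evj // !(evt s j _ (cwf _ cs)).
Qed.

Lemma resolve_job_triple t0 (i : 'I_n) :
  triple (fun s => ivar s 2 = i /\ checked (fun w => w.1.1 < i)%N t0 s) resolve_job
         (checked (fun w => w.1.1 < i.+1)%N t0) 13.
Proof.
apply: (triple_if D0 K0 N0 U_large) => //.
- by move=> s [_ [[/wf_bounded]]].
- apply: (triple_skip U_large) => // s [[i2 cs] /=].
  have [[_ _ mk _ _] _ _] := cs; rewrite i2 mk; case: (boolP (i \in p)) => // ip _.
  case: cs => h1 h2 h3; split=> //; case: h3 => [[h3 h4]|]; [left|by right].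
  split=> // w; rewrite ltnS leq_eqVlt => /orP[/eqP/val_inj wi|/h4 //].
  by rewrite /blocks wi inE (negPf ip).
case: (boolP (i \in p)) => ip; last first.
  move=> s [[i2 cs] /=]; have [[_ _ mk _ _] _ _] := cs.
  by rewrite i2 mk (negPf ip).
have four := triple_seq
  (@resolve_triple (fun w : 'I_n * bool * bool => w.1.1 < i)%N t0 i false false ip)
  (triple_seq (@resolve_triple _ t0 i false true ip)
  (triple_seq (@resolve_triple _ t0 i true false ip)
   (@resolve_triple _ t0 i true true ip))).
apply: triple_weaken _ _ _ four => //; first by move=> s [].
move=> s [_ [h1 h2 h3]]; split=> //; case: h3 => [[h3 h4]|]; [left|by right].
split=> // -[[x z] v] /=; rewrite ltnS leq_eqVlt => /orP[/eqP/val_inj ->|xi]; apply: h4.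
  by case: z; case: v; rewrite /= ?eqxx ?orbT.
by rewrite /= xi !orbT.
Qed.

Lemma pass_triple t0 :
  triple (checked pred0 t0) pass (checked predT t0) (for_cost n 13).
Proof.
apply: triple_weaken _ _ _ (triple_for D0 K0 N0 U_large
  (I := fun i => checked (fun w => w.1.1 < i)%N t0) _ _ _ _ _) => //.
- move=> s [h1 h2 h3]; split=> //; case: h3 => [[h3 h4]|]; [left|by right]; split=> // w _.
  by apply: h4; rewrite /= ltn_ord.
- by move=> i s [[[h1 h2 _ _ _]]].
- move=> i v s [h1 h2 h3] vn; split=> //; apply: searching_iset => //.
  by rewrite /N; lia.
- by move=> i i_n; exact: (@resolve_job_triple t0 (Ordinal i_n)).
Qed.

(** After [r] passes the tentative start is admissible or the potential is at least [r]; the latter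
    is impossible for [r = 4 n + 1]. *)
Lemma place_triple :
  triple (fun s => searching s) place
    (fun s => searching s /\ earliest a b L S0 J j (sol s j))
    (for_cost N (for_cost n 13)).
Proof.
apply: triple_weaken _ _ _ (triple_for D0 K0 N0 U_large (I := fun r s => searching s /\
  (starts S0 J j (sol s j) \/ (r <= released a b L S0 j (sol s j))%N)) _ _ _ _ _) => //.
- by move=> s h; split=> //; right.
- move=> s [h [h1|h1]]; split=> //.
    by split=> //; case: h => _ _ _ _ [].
  have : (released a b L S0 j (sol s j) <= 4 * n)%N by exact: released_le.
  by move: h1; rewrite /N; lia.
- by move=> r s [[[h1 h2 _ _ _] _ _ _ _] _]; split=> //=; rewrite h2 /N; lia.
- by move=> r v s [h1 h2] vN; split=> //; apply: searching_iset.
- move=> r rN s [_ [ss hr]].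
  have [|s' [T [e hT [ss' ts' disj]]]] := @pass_triple (sol s j) s.
    by split=> //; left.
  exists s', T; split=> //; split=> //.
  have [_ _ _ _ [_ _ low']] := ss'.
  case: hr => [st|hr].
    (* An admissible start does not move any more: the new value is at least the old one and at most
       every admissible start. *)
    by left; have -> : sol s' j = sol s j by apply/eqP; rewrite eq_le ts' low'.
  case: disj => [[e1 nb]|lt1]; last by right; apply: leq_ltn_trans lt1.
  left; rewrite e1; apply/can_startP => //; split; last by move=> w; apply: nb.
  by have [_ _ _ _ []] := ss.
Qed.

End Search.

(** * Selection of the next job and the main loop *)

Definition selecting (p : seq 'I_n) (S0 : 'I_n -> rat) (i : nat) (s : state) : Prop :=
  [/\ wf s, marks p s, sol s =1 S0 &
      exists2 j : 'I_n, ivar s 3 = j &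
        forall x : 'I_n, (x < i)%N -> x \notin p -> j \notin p /\ L j <= L x].

Lemma select_triple p S0 : (0 < n)%N ->
  triple (fun s => [/\ wf s, marks p s & sol s =1 S0]) select (selecting p S0 n)
    (1 + for_cost n 4).
Proof.
move=> npos; apply: triple_seq (_ : triple _ _ (selecting p S0 0) _) _.
  apply: (triple_iset D0 K0 N0 U_large) => // s [h1 h2 h3]; split; first exact: wf_bounded.
  by split=> //; [exact: wf_iset|exists (Ordinal npos)].
apply: (triple_for D0 K0 N0 U_large) => //.
- by move=> i s [[h1 h2 _ _ _]].
- move=> i v s [h1 h2 h3 h4] vn; split=> //; apply: wf_iset => //.
  by rewrite /N; lia.
move=> i i_n; pose o := Ordinal i_n.
have bnd s : ivar s 2 = i /\ selecting p S0 i s -> bounded s.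
  by case=> _ [/wf_bounded].
(* [old] handles the branches that keep the candidate, and [new] those that replace it by job
   [i]. *)
have old s : selecting p S0 i s ->
    (exists2 j : 'I_n, ivar s 3 = j & j \notin p /\ L j <= L o) \/ o \in p ->
    selecting p S0 i.+1 s.
  move=> [h1 h2 h3 [j j3 hj]] h; split=> //; exists j => // x.
  rewrite ltnS leq_eqVlt => /orP[/eqP xi|]; last exact: hj.
  have -> : x = o by exact: val_inj.
  case: h => [[j' j3' ?] _|-> //].
  by have -> : j = j' by apply: val_inj; rewrite /= -j3 -j3'.
have new s : ivar s 2 = i -> selecting p S0 i s -> o \notin p ->
    (forall j : 'I_n, ivar s 3 = j -> j \in p \/ L o <= L j) ->
    selecting p S0 i.+1 (iset s 3 (ivar s 2)).
  move=> i2 [h1 h2 h3 [j j3 hj]] op h; split=> //.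
    by apply: wf_iset => //; rewrite i2 /N; lia.
  exists o => [|x]; first by rewrite /= i2.
  rewrite ltnS leq_eqVlt => /orP[/eqP xi _|xi xp].
    have -> // : x = o by exact: val_inj.
  have [jp Lj] := hj x xi xp; split=> //.
  by case: (h j j3) => [|Lo]; [rewrite (negPf jp)|exact: le_trans Lj].
have mark (x : 'I_n) s y : ivar s y = x -> marks p s ->
    teval s (QLt (QGet 4 (IVar y)) (QNum 1)) = (x \notin p).
  by move=> /= -> ->; case: (x \in p).
apply: (triple_if D0 K0 N0 U_large) => //; last first.
  apply: (triple_skip U_large) => // s [[i2 cs] h].
  apply: (old) => //; right; have [_ mk _ _] := cs.
  by move: h; rewrite (mark o) // negbK.
apply: (triple_if D0 K0 N0 U_large) => //; first by move=> s [/bnd].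
  apply: (triple_if D0 K0 N0 U_large) => //; first by move=> s [[/bnd]].
    apply: (triple_iset D0 K0 N0 U_large) => // s [[[[i2 cs] h1] h2] h3].
    split; first exact: bnd.
    have [ws mk _ [j j3 _]] := cs; apply: new => //; first by rewrite -(mark o s 2%N).
    move=> x x3; right; move: h3; rewrite /= i2 x3.
    by have [_ _ _ _ hL] := ws; rewrite hL (hL o) => /ltW.
  apply: (triple_skip U_large) => // s [[[[i2 cs] h1] h2] h3]; apply: old => //; left.
  have [ws mk _ [j j3 _]] := cs; exists j => //; split; first by rewrite -(mark j s 3%N).
  by move: h3; have [_ _ _ _ hL] := ws; rewrite /= i2 j3 (hL o) hL -leNgt.
apply: (triple_iset D0 K0 N0 U_large) => // s [[[i2 cs] h1] h2].
split; first exact: bnd.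
have [ws mk _ [j j3 _]] := cs; apply: new => //; first by rewrite -(mark o s 2%N).
by move=> x x3; left; move: h2; rewrite (mark x) // negbK.
Qed.

Definition scheduled (k : nat) (s : state) : Prop :=
  wf s /\ exists p, [/\ size p = k, greedy_run a b L (sol s) p, marks p s
    & forall i, i \in p -> 0 <= sol s i <= (k * M)%:R].

Lemma schedule_next_triple k : (k < n)%N ->
  triple (scheduled k) schedule_next (scheduled k.+1)
    (1 + for_cost n 4 + (1 + (for_cost N (for_cost n 13) + 1))).
Proof.
move=> kn s [ws [p [sp run mk bnd]]].
have npos : (0 < n)%N by apply: leq_ltn_trans kn.
(* An unscheduled job exists because [k < n]; this forces the job returned by [select] to be
   unscheduled. *)
have [x0 x0p] : exists i, i \notin p by apply: exists_notin; rewrite sp card_ord.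
pose S0 := sol s.
pose Q (j : 'I_n) s' := [/\ searching p j S0 k s', j \notin p & forall x, x \notin p -> L j <= L x].
suff H : triple (fun s => [/\ wf s, marks p s & sol s =1 S0]) schedule_next
    (scheduled k.+1) (1 + for_cost n 4 + (1 + (for_cost N (for_cost n 13) + 1))).
  by apply: H.
apply: triple_seq (@select_triple p S0 npos) _.
apply: triple_seq (_ : triple _ _ (fun s' => exists j, Q j s') _) _.
  apply: (triple_qset D0 K0 N0 U_large) => // s1 [ws1 mk1 eS [j j3 jmin]].
  split; first exact: wf_bounded.
  have {}jmin x : x \notin p -> j \notin p /\ L j <= L x by apply: jmin.
  have [jp _] := jmin _ x0p.
  have sj : sol (qset s1 3 (ieval s1 (IVar 3)) 0) j = 0 by rewrite /sol /= j3 eqxx.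
  exists j; split=> //; last by move=> x /jmin[].
  split=> //; first by apply: wf_qset => //; apply: (grid_nat _ (x := 0)).
    move=> x xp; rewrite -eS /sol /= j3 val_eqE ifN //.
    by apply: contraNneq jp => <-.
  by rewrite sj; split=> // t [].
have tri j (jp : j \notin p) := place_triple jp kn bnd.
apply: triple_seq (_ : triple _ _ (fun s' => exists j,
    Q j s' /\ earliest a b L S0 [set i in p] j (sol s' j)) _) _.
  move=> s1 [j [ss jp jmin]]; have [s2 [T [e hT [ss2 ear]]]] := tri j jp s1 ss.
  by exists s2, T; split=> //; exists j.
apply: (triple_qset D0 K0 N0 U_large) => // s1 [j [[[ws1 j3 mk1 eS [t_ge t_le low]] jp jmin] ear]].
split; first exact: wf_bounded.
split; first by apply: wf_qset => //; apply: (grid_nat _ (x := 1)).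
have eS' : {in p, S0 =1 sol s1} by move=> x xp; rewrite eS.
exists (j :: p); split.
- by rewrite /= sp.
- split=> //; last by exact: eq_greedy_run run.
  by apply: eq_earliest ear => // x; rewrite inE; apply: eS'.
- by move=> x; rewrite /= j3 val_eqE inE mk1; case: eqP.
- move=> x; rewrite inE => /predU1P[->|xp]; first by apply/andP.
  rewrite /sol /= -/(sol s1 x) eS //; have /andP[-> h] := bnd x xp.
  by apply: (le_trans h); rewrite ler_nat leq_mul2r leqnSn orbT.
Qed.

Lemma schedule_all_triple :
  triple (scheduled 0) schedule_all (scheduled n)
    (for_cost n (1 + for_cost n 4 + (1 + (for_cost N (for_cost n 13) + 1)))).
Proof.
apply: (triple_for D0 K0 N0 U_large) => //.
- by move=> i s [[h1 h2 _ _ _] _].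
- move=> i v s [h1 h2] vn; split=> //; apply: wf_iset => //; rewrite /N; lia.
- move=> k kn; apply: triple_weaken _ _ _ (schedule_next_triple kn) => // s [] //.
Qed.

Lemma scheduled_input :
  grid D M a -> grid D M b -> (forall j, grid D M (L j)) ->
  scheduled 0 (input_state a b L).
Proof.
move=> ga gb gL.
have MK : (M <= K)%N by rewrite /K leq_pmull.
split; last by exists [::]; split.
split=> //=; last by move=> j; rewrite valK.
split=> [x|A i] /=; first by case: ifP => _ //; rewrite /N; lia.
have g0 : grid D K 0 by apply: (grid_nat _ (x := 0)).
case: A => [|[|[|A]]].
- by case: i => [|i] //; apply: gridW MK _.
- by case: i => [|i] //; apply: gridW MK _.
- by case: insubP => [j _ _|_] //; apply: gridW MK (gL j).
- by case: i.
Qed.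

End Program.

(** * The running time in terms of the input size *)

Lemma absz_num_ge (q : rat) : 0 <= q -> q <= `|numq q|%:R.
Proof.
move=> q0; rewrite -{1}(divq_num_den q) natr_absz ger0_norm ?numq_ge0 //.
have n0 : 0 <= (numq q)%:~R :> rat by rewrite ler0z numq_ge0.
have d1 : 1 <= (denq q)%:~R :> rat by rewrite ler1z -gtz0_ge1 denq_gt0.
by rewrite ler_pdivrMr ?(lt_le_trans ltr01) // ler_peMr.
Qed.

Lemma mulr_denq_int (q : rat) d : (`|denq q| %| d)%N -> q * d%:R \is a Num.int.
Proof.
move=> /dvdnP[x ->]; rewrite natrM mulrCA rpredM ?natr_int //.
rewrite natr_absz (gtr0_norm (denq_gt0 q)) -{1}(divq_num_den q).
by rewrite divfK ?intr_int // intr_eq0 denq_neq0.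
Qed.

Lemma schedule_all_poly : exists k m : nat,
  forall (n : nat) (a b : rat) (L : 'I_n -> rat),
    0 < a -> 0 < b -> (forall j, 0 <= L j) ->
    exists (s : state) (T : nat),
      [/\ exec schedule_all (input_state a b L) s T,
          (T <= k * input_size a b L ^ m)%N
        & algorithm1 (fun=> a) L (fun=> b) (output (n := n) s)].
Proof.
(* With input size [I], the program takes at most [100 * I ^ 3] units, and a unit is
   [1000 * wordsize], at most [1000 * (20 * I)]. *)
exists (100 * (1000 * 20))%N, 4%N => n a b L a0 b0 L0.
pose D := (`|denq a| * (`|denq b| * \prod_j `|denq (L j)|))%N.
pose M := (1 + (`|numq a| + (`|numq b| + \sum_j `|numq (L j)|)))%N.
pose K := (n.+1 * M)%N; pose N := (4 * n + 1)%N.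
pose U := (1000 * wordsize D K N)%N; pose I := input_size a b L.
have den0 q : (0 < `|denq q|)%N by rewrite absz_gt0 denq_neq0.
have D0 : (0 < D)%N by rewrite !muln_gt0 !den0 prodn_gt0.
have M0 : (0 < M)%N by [].
have ge_a := absz_num_ge (ltW a0); have ge_b := absz_num_ge (ltW b0).
have ge_L j : L j <= (\sum_j `|numq (L j)|)%N%:R.
  apply: le_trans (absz_num_ge (L0 j)) _.
  by rewrite ler_nat (bigD1 j) //= leq_addr.
have ME : M%:R = 1 + (`|numq a|%:R + (`|numq b|%:R + (\sum_j `|numq (L j)|)%N%:R)) :> rat.
  by rewrite !natrD.
have sum0 : 0 <= (\sum_j `|numq (L j)|)%N%:R :> rat by rewrite ler0n.
have ga : grid D M a.
  rewrite /grid mulr_denq_int ?dvdn_mulr //= ger0_norm ?ltW // ME; lra.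
have gb : grid D M b.
  have db : (`|denq b| %| D)%N by apply: dvdn_mull; apply: dvdn_mulr.
  rewrite /grid mulr_denq_int //= ger0_norm ?ltW // ME; lra.
have gL j : grid D M (L j).
  have dL : (`|denq (L j)| %| D)%N.
    by do 2!apply: dvdn_mull; rewrite (bigD1 j) //= dvdn_mulr.
  rewrite /grid mulr_denq_int //= ger0_norm //; have := ge_L j; rewrite ME; lra.
have abL j : a + b + L j <= M%:R by have := ge_L j; rewrite ME; lra.
have init : scheduled a b L D M 0 (input_state a b L).
  exact: (scheduled_input a0 b0 D0 M0 (leqnn U) ga gb gL).
have := schedule_all_triple a0 b0 L0 D0 M0 abL (leqnn U).
move=> /(_ _ init) [s [T [e hT [_ [p [sp run _ _]]]]]].
exists s, T; split=> //; last exact: greedy_run_algorithm1 run sp.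
apply: leq_trans hT _.
(* The number of jobs is bounded through the delays: every rational takes at least two bits. *)
have n2 : (2 * n + 4 <= I)%N.
  have h q : (2 <= qbits q)%N by rewrite /qbits /nbits; lia.
  have hs : (2 * n <= \sum_j qbits (L j))%N.
    rewrite -[(2 * n)%N]addn0 -iter_addn -big_const_ord.
    by apply: leq_sum => j _; exact: h.
  by rewrite /I /input_size; have := h a; have := h b; lia.
have split_sum : (\sum_j qbits (L j) = \sum_j nbits `|numq (L j)| + \sum_j nbits `|denq (L j)|)%N.
  by rewrite -big_split.
have IE : I = (nbits `|numq a| + nbits `|denq a| + (nbits `|numq b| + nbits `|denq b|) +
    (\sum_j nbits `|numq (L j)| + \sum_j nbits `|denq (L j)|))%N.
  by rewrite /I /input_size split_sum.
have bD : (nbits D <= 1 + I)%N.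
  apply: leq_trans (nbits_mul _ _) _.
  apply: leq_trans (leq_add (leqnn _) (nbits_mul _ _)) _.
  apply: leq_trans (leq_add (leqnn _) (leq_add (leqnn _) (nbits_prod _ _))) _.
  rewrite IE; lia.
have bM : (nbits M <= 2 + I)%N.
  apply: leq_trans (nbits_add _ _) _.
  apply: leq_trans (leq_add (leqnn _) (nbits_add _ _)) _.
  apply: leq_trans (leq_add (leqnn _) (leq_add (leqnn _) (nbits_add _ _))) _.
  apply: leq_trans (leq_add (leqnn _) (leq_add (leqnn _) (leq_add (leqnn _) (nbits_sum _ _)))) _.
  rewrite IE (_ : nbits 1 = 1%N) //; lia.
have W : (wordsize D K N <= 20 * I)%N.
  rewrite /wordsize; have := nbits_mul K D; have := nbits_mul n.+1 M.
  rewrite -/K; have := nbits_leqS n.+1; have := nbits_leqS N; rewrite /N; lia.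
have C : (for_cost n (1 + for_cost n 4 + (1 + (for_cost N (for_cost n 13) + 1))) <= 100 * I ^ 3)%N.
  have nI : (n.+1 <= I)%N by lia.
  apply: (@leq_trans (100 * n.+1 ^ 3)); last by rewrite leq_mul2l leq_exp2r.
  by rewrite /for_cost /N; nia.
apply: leq_trans (leq_mul C (leq_mul (leqnn 1000) W)) _.
by rewrite (mulnA 1000) mulnACA -expnSr.
Qed.

Theorem theorem4 :
  (exists (c : cmd) (k m : nat),
     forall (n : nat) (a b : rat) (L : 'I_n -> rat),
       0 < a -> 0 < b -> (forall j, 0 <= L j) ->
       exists (s : state) (T : nat),
         [/\ exec c (input_state a b L) s T,
             (T <= k * input_size a b L ^ m)%N
           & algorithm1 (fun=> a) L (fun=> b) (output (n := n) s)]) /\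
  (forall (R : realFieldType) (n : nat) (a b : R) (L : 'I_n -> R),
     0 < a -> 0 < b -> b <= a -> (forall j, 0 <= L j) ->
     (exists S : 'I_n -> R, algorithm1 (fun=> a) L (fun=> b) S) /\
     (forall S : 'I_n -> R, algorithm1 (fun=> a) L (fun=> b) S ->
        feasible (fun=> a) L (fun=> b) S /\
        (forall S' : 'I_n -> R, feasible (fun=> a) L (fun=> b) S' ->
           sum_completion (fun=> a) L (fun=> b) S
             <= 2 * sum_completion (fun=> a) L (fun=> b) S'))).
Proof.
split; first by exists schedule_all; exact: schedule_all_poly.
move=> R n a b L a0 b0 ba L0; split; first exact: algorithm1_exists.
move=> S alg; split; first exact: algorithm1_feasible alg.
by move=> S' feas; exact: algorithm1_approx alg feas.
Qed.
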